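(* Every non-empty ultrametrizable topological space is homeomorphic to a clade space of a pruned tree. That is, if $(X,\mathcal{O})$ is a non-empty topological space whose topology is induced by some ultrametric, then there exist a non-empty alphabet $\mathcal{A}$, a pruned tree $T$ over $\mathcal{A}$, and a non-empty set of branches $P\subseteq [T]$ such that $(X,\mathcal{O})$ is homeomorphic to $P$ endowed with the tree topology.
   Context: $\mathbb{N}=\{0,1,2,\dots\}$. An ultrametric on $X$ is a metric $d$ on $X$ with $d(x,y)\le\max\{d(x,z),d(z,y)\}$ for all $x,y,z$. A topological space is ultrametrizable if some ultrametric induces its topology. Let $\mathcal{A}$ be a non-empty set (an alphabet). A tree over $\mathcal{A}$ is a non-empty set $T\subseteq\bigcup_{k\in\mathbb{N}}\mathcal{A}^k$ of finite sequences (called positions) closed under taking prefixes. It is pruned if every $p\in T$ is a strict prefix of some $p'\in T$. A branch of $T$ is an infinite sequence in $\mathcal{A}^{\mathbb{N}}$ all of whose finite prefixes are in $T$; the set of all branches, the canopy of $T$, is denoted $[T]$. For $p\in T$ let $T_p=\{p'\in T: p'\text{ is a prefix of }p\text{ or }p\text{ is a prefix of }p'\}$ (prefixes not necessarily strict), so $[T_p]$ is the set of branches of $T$ having $p$ as a prefix. The tree topology on $[T]$ is the topology generated by the basis $\{[T_p]: p\in T\}$. For a non-empty $P\subseteq[T]$, the tree topology on $P$ is the subspace topology; $P$ with this topology is called a clade space of the pruned tree $T$. *)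

(* Defs.v *)
From HB Require Import structures.
From mathcomp Require Import all_boot all_order all_algebra.
From mathcomp Require Import all_classical all_reals topology.

Set Implicit Arguments.
Unset Strict Implicit.
Unset Printing Implicit Defensive.

Import Order.TTheory GRing.Theory Num.Theory.

Local Open Scope classical_set_scope.
Local Open Scope ring_scope.

Record is_metric (R : realType) (X : Type) (d : X -> X -> R) : Prop := {
  metric_ge0 : forall x y, 0 <= d x y;
  metric_eq0 : forall x y, d x y = 0 <-> x = y;
  metric_symm : forall x y, d x y = d y x;
  metric_tri : forall x y z, d x y <= d x z + d z y }.

Record is_ultrametric (R : realType) (X : Type) (d : X -> X -> R) : Prop := {
  ultrametric_metric : is_metric d;
  ultrametric_max : forall x y z, d x y <= Num.max (d x z) (d z y) }.

Definition induces_topology (R : realType) (X : topologicalType)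
    (d : X -> X -> R) : Prop :=
  forall U : set X, open U <->
    forall x, U x -> exists2 e : R, 0 < e & [set y | d x y < e] `<=` U.

Definition ultrametrizable (R : realType) (X : topologicalType) : Prop :=
  exists d : X -> X -> R, is_ultrametric d /\ induces_topology d.

Definition homeomorphic (X Y : topologicalType) : Prop :=
  exists (f : X -> Y) (g : Y -> X),
    [/\ cancel f g, cancel g f, continuous f & continuous g].

Section Trees.
Variable A : choiceType.
Implicit Types (T : set (seq A)) (p q : seq A).

Definition is_tree T : Prop :=
  T !=set0 /\ forall p q, prefix p q -> T q -> T p.

Definition pruned T : Prop :=
  forall p, T p -> exists q, [/\ T q, prefix p q & p != q].

Definition canopy T : set (nat -> A) := [set b | forall n, T (mkseq b n)].

Definition comparable_positions T p : set (seq A) :=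
  [set q | T q /\ (prefix q p || prefix p q)].

(* A name distinct from [set_type (canopy T)], on which the library would look
   for the topology induced by a topology on [nat -> A]. *)
Definition canopy_space T : Type := set_type (canopy T).

HB.instance Definition _ T :=
  Choice.copy (canopy_space T) (set_type (canopy T)).

(* The branches of the tree T_p of the positions of T comparable with p. *)
Definition cylinder T p : set (canopy_space T) :=
  [set b : canopy_space T | canopy (comparable_positions T p) (set_val b)].
Arguments cylinder : clear implicits.

Lemma cylinder_cover T : \bigcup_(p in T) cylinder T p = setT.
Proof.
apply/seteqP; split=> // b _; have Tb : canopy T (set_val b) by exact: set_valP.
by exists [::]; [exact: (Tb 0%N)|move=> n; split; [exact: Tb|rewrite prefix0s orbT]].
Qed.

Lemma comparable_positions_sub T p q : prefix p q ->
  comparable_positions T q `<=` comparable_positions T p.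
Proof.
move=> pq r [Tr rq]; split=> //; case/orP: rq => [rq|qr]; last first.
  by rewrite (prefix_trans pq qr) orbT.
case: (leqP (size r) (size p)) => [rp|/ltnW pr].
  move: rq pq; rewrite !prefixE => /eqP rE /eqP pE.
  by rewrite -[X in take (size r) X]pE take_takel // rE eqxx.
move: rq pq; rewrite !prefixE => /eqP rE /eqP pE.
by rewrite -[X in take (size p) X]rE take_takel // pE eqxx orbT.
Qed.

Lemma cylinder_mkseq T p b : cylinder T p b -> mkseq (set_val b) (size p) = p.
Proof.
move=> /(_ (size p))[_]; rewrite !prefixE size_mkseq take_size.
by rewrite -[X in take X (mkseq _ _)](size_mkseq (set_val b)) take_size
  eq_sym orbb => /eqP.
Qed.

Lemma cylinder_join T p q b : T p -> T q -> cylinder T p b -> cylinder T q b ->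
  exists r, [/\ T r, cylinder T r b &
    cylinder T r `<=` cylinder T p `&` cylinder T q].
Proof.
wlog pq : p q / (size p <= size q)%N => [hw Tp Tq bp bq|].
  case: (leqP (size p) (size q)) => [h|/ltnW h]; first exact: hw.
  by have [r [? ? ?]] := hw q p h Tq Tp bq bp; exists r; rewrite setIC.
move=> Tp Tq bp bq; exists q; split=> // c cq; split=> // n.
apply: (@comparable_positions_sub T p q); last exact: cq.
rewrite prefixE -(cylinder_mkseq bq) -{2}(cylinder_mkseq bp).
by rewrite /mkseq -map_take take_iota (minn_idPl pq).
Qed.

(* The factory requires a pointed index type, hence this pointed copy. *)
Definition position : Type := seq A.
HB.instance Definition _ := Choice.on position.
HB.instance Definition _ := isPointed.Build position [::].

(* The tree topology: the basis consists of the cylinders at the p in T. *)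
HB.instance Definition _ T := @isBaseTopological.Build (canopy_space T)
  position T (cylinder T) (cylinder_cover T) (@cylinder_join T).

End Trees.

Arguments cylinder {A} T p.

(* Main.v *)
Require Import Defs.
From mathcomp Require Import all_boot all_order all_algebra.
From mathcomp Require Import all_classical all_reals topology.

Import Order.TTheory GRing.Theory Num.Theory.

Local Open Scope classical_set_scope.

(** Why the theorem is true.  Let [d] be an ultrametric inducing the topology
    of [X].  Encode a point [x] by the infinite sequence of its open balls of
    radii 1, 1/2, 1/3, ...; the alphabet is the set of subsets of [X], the tree
    consists of all finite words, and [P] is the set of codes of points.

    In an ultrametric space every point of a ball is a centre of it
    ([ultrametric_ball_eq]), so the [n]-th letters of the codes of [x] and [y]
    agree exactly when [d x y < 1 / n.+1], and two codes share a prefix of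
    length [n.+1] exactly when this holds ([ball_code_prefix]).  Sharing long
    prefixes is thus the same as being close, which gives at once that the code
    is injective and that it is continuous with continuous inverse, once open
    sets of the tree topology are described by common prefixes
    ([open_canopyP]). *)

Section CanopyTopology.
Context {A : choiceType} {T : set (seq A)}.

Lemma mkseq_prefix (b : nat -> A) (m n : nat) :
  (m <= n)%N -> prefix (mkseq b m) (mkseq b n).
Proof.
move=> mn; rewrite prefixE size_mkseq /mkseq -map_take take_iota.
by rewrite (minn_idPl mn).
Qed.

(** Positions comparable with [p] contain every finite prefix of [b] as soon as
    [p] itself is such a prefix, since two prefixes of [b] are comparable. *)
Lemma cylinderE (p : seq A) (b : canopy_space T) :
  cylinder T p b <-> mkseq (set_val b) (size p) = p.
Proof.
split=> [|<- n]; first exact: cylinder_mkseq.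
have Tb : canopy T (set_val b) by exact: set_valP.
split; first exact: Tb.
by case: (leqP n (size p)) => [|/ltnW] /mkseq_prefix -> //; rewrite orbT.
Qed.

(** The cylinders at the prefixes of [b] form a neighbourhood base of [b]; this
    puts openness in the same form as [induces_topology]. *)
Lemma open_canopyP (U : set (canopy_space T)) :
  open U <-> forall b, U b -> exists n, forall c : canopy_space T,
    mkseq (set_val c) n = mkseq (set_val b) n -> U c.
Proof.
split=> [[D DT <-] b [p Dp /cylinderE bp]|nU].
  exists (size p) => c cb; exists p => //; apply/cylinderE; rewrite cb.
  exact: bp.
exists [set p | T p /\ cylinder T p `<=` U]; first by move=> p [].
apply/seteqP; split=> [b [p [_ pU]] /pU //|b Ub].
have [n nUb] := nU b Ub; exists (mkseq (set_val b) n); last first.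
  by apply/cylinderE; rewrite size_mkseq.
split; first exact: (set_valP b).
by move=> c /cylinderE; rewrite size_mkseq; exact: nUb.
Qed.

End CanopyTopology.

Lemma is_tree_setT (A : choiceType) : is_tree [set: seq A].
Proof. by split=> //; exists [::]. Qed.

Lemma pruned_setT {A : choiceType} : [set: A] !=set0 -> pruned [set: seq A].
Proof.
move=> [a _] p _; exists (rcons p a); split=> //; first exact: prefix_rcons.
by apply/eqP => /(congr1 size)/eqP; rewrite size_rcons ltn_eqF.
Qed.

Lemma exists_invn_lt {R : realType} {e : R} :
  (0 < e)%R -> exists n, (n.+1%:R^-1 < e)%R.
Proof.
move=> e0; exists (Num.truncn e^-1); rewrite invf_plt ?posrE ?ltr0n//.
exact: truncnS_gt.
Qed.

Definition ball_code {R : realType} {X : Type} (d : X -> X -> R)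
    (x : X) (n : nat) : set X :=
  [set y | (d x y < n.+1%:R^-1)%R].

Section BallCode.
Context {R : realType} {X : Type} {d : X -> X -> R}.
Hypothesis d_ultra : is_ultrametric d.

Let d_metric : is_metric d := ultrametric_metric d_ultra.

(** The ultrametric inequality makes every point of a ball a centre of it;
    conversely [y] belongs to its own ball. *)
Lemma ultrametric_ball_eq (x y : X) (r : R) : (0 < r)%R ->
  [set z | (d x z < r)%R] = [set z | (d y z < r)%R] <-> (d x y < r)%R.
Proof.
move=> r0; split=> [E|xy].
  have : [set z | (d y z < r)%R] y.
    by rewrite /= (proj2 (metric_eq0 d_metric y y) erefl).
  by rewrite -E.
apply/seteqP; split=> z /= h.
  apply: le_lt_trans (ultrametric_max d_ultra y z x) _.
  by rewrite gt_max (metric_symm d_metric y x) xy.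
apply: le_lt_trans (ultrametric_max d_ultra x z y) _.
by rewrite gt_max xy.
Qed.

Lemma ball_codeE (x y : X) (n : nat) :
  ball_code d x n = ball_code d y n <-> (d x y < n.+1%:R^-1)%R.
Proof. by apply: ultrametric_ball_eq; rewrite invr_gt0 ltr0n. Qed.

(** The radii decrease, so agreement of the last letter of a prefix forces
    agreement of all the earlier ones. *)
Lemma ball_code_prefix (x y : X) (n : nat) :
  mkseq (ball_code d x) n.+1 = mkseq (ball_code d y) n.+1 <->
  (d x y < n.+1%:R^-1)%R.
Proof.
split=> [E|xy].
  apply/ball_codeE; have := congr1 (fun s => nth set0 s n) E.
  by rewrite !nth_mkseq.
apply/eq_in_map => i; rewrite mem_iota ltnS => /= i_n.
apply/ball_codeE; apply: lt_le_trans xy _.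
by rewrite lef_pV2 ?posrE ?ltr0n// ler_nat ltnS.
Qed.

Lemma ball_code_inj : injective (ball_code d).
Proof.
move=> x y E; apply/(metric_eq0 d_metric)/eqP.
rewrite eq_le (metric_ge0 d_metric) andbT; apply/ler_addgt0Pl => e e0.
rewrite addr0.
have [n ne] := exists_invn_lt e0.
by apply/ltW/(lt_trans _ ne)/ball_codeE; rewrite E.
Qed.

End BallCode.

Theorem corollary4p14 (R : realType) (X : topologicalType)
    (X_neq0 : [set: X] !=set0) (X_ultra : ultrametrizable R X) :
  exists (A : choiceType) (T : set (seq A)) (P : set (canopy_space T)),
    [/\ [set: A] !=set0, is_tree T, pruned T, P !=set0 &
        homeomorphic X (set_type P)].
Proof.
have [d [d_ultra d_top]] := X_ultra.
pose A : choiceType := set X; pose T : set (seq A) := setT.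
have A_neq0 : [set: A] !=set0 by exists set0.
pose code (x : X) : canopy_space T :=
  exist _ (ball_code d x) (mem_set (fun=> I)).
have codeK x : set_val (code x) = ball_code d x by [].
pose P : set (canopy_space T) := range code.
exists A, T, P; split=> //.
- exact: is_tree_setT.
- exact: pruned_setT.
- by have [x _] := X_neq0; exists (code x); exists x.
pose f (x : X) : set_type P := exist _ (code x) (mem_set (imageT code x)).
have f_surj (b : set_type P) : exists x, code x = set_val b.
  by have [x _ xb] := set_valP b; exists x.
pose g (b : set_type P) : X := projT1 (cid (f_surj b)).
have gE b : code (g b) = set_val b := projT2 (cid (f_surj b)).
have fK : cancel f g.
  by move=> x; apply: (ball_code_inj d_ultra); rewrite -codeK gE.
have gK : cancel g f by move=> b; apply: val_inj; exact: gE.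
exists f, g; split=> //; apply/continuousP.
  move=> _ [U /open_canopyP U_open <-]; apply/d_top => x /U_open[n nU].
  exists n.+1%:R^-1%R; first by rewrite invr_gt0 ltr0n.
  move=> y /(ball_code_prefix d_ultra) xy; apply: nU.
  (* The ball around [x] controls one letter more than the prefix requires. *)
  have := congr1 (take n) xy.
  by rewrite /mkseq -!map_take !take_iota (minn_idPl (leqnSn n)) => ->.
move=> U /d_top U_open.
(* [code @` U] need not be open in the canopy, which may contain branches that
   code no point; the open set taken is a union of cylinders around it. *)
pose V : set (canopy_space T) := [set c | exists n x, ball_code d x n `<=` U /\
  mkseq (set_val c) n.+1 = mkseq (ball_code d x) n.+1].
exists V.
  apply/open_canopyP => b [n [x [xU xb]]]; exists n.+1 => c cb.
  by exists n, x; split=> //; rewrite cb.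
apply/seteqP; split=> b /=.
  move=> [n [x [xU]]]; rewrite -gE codeK => E.
  by apply: xU; apply/(ball_code_prefix d_ultra); rewrite E.
move=> Ub; have [e e0 eU] := U_open _ Ub.
have [n ne] := exists_invn_lt e0.
exists n, (g b); rewrite -gE codeK; split=> // y yn; apply: eU.
exact: lt_trans yn ne.
Qed.
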